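(* Let $n\ge 5$ be an integer, and call an $n$-vertex graph extremal for $P^2_5$ if it contains no subgraph isomorphic to $P^2_5$ and has exactly $\mathrm{ex}(n,P^2_5)$ edges. Up to isomorphism: (i) for $n=5$ the extremal graphs for $P^2_5$ are exactly $E^2_5$, $E^3_5$ and $G_0$, where $G_0$ is $K_4$ together with one pendant edge (a fifth vertex joined to exactly one vertex of the $K_4$); (ii) for $n\ge 6$ with $n\equiv 1 \pmod 4$, the extremal graphs are exactly $E^{\lceil n/2\rceil}_n$ and $E^{\lfloor n/2\rfloor}_n$; (iii) for $n\ge 6$ with $n\equiv 2 \pmod 4$, the extremal graphs are exactly $E^{n/2}_n$ and $E^{n/2+1}_n$; (iv) for $n\ge 6$ with $n\equiv 0,3\pmod 4$, the only extremal graph is $E^{\lceil n/2\rceil}_n$.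
   Context: All graphs are finite, simple and undirected. $P^2_k$ is the square of the path on $k$ vertices $v_1,\dots,v_k$: $v_i,v_j$ adjacent iff $1\le|i-j|\le 2$. $\mathrm{ex}(n,H)$ is the maximum number of edges in an $n$-vertex graph not containing $H$ as a subgraph. For $1\le i\le n-1$, $E^i_n$ denotes the graph obtained from the complete bipartite graph $K_{i,n-i}$ with classes $X$ ($|X|=i$) and $Y$ ($|Y|=n-i$) by adding a maximum matching inside $X$ (i.e. $\lfloor i/2\rfloor$ pairwise disjoint edges with both ends in $X$). *)

(* Defs.v *)
From mathcomp Require Import all_boot ssrint.

Set Implicit Arguments.
Unset Strict Implicit.
Unset Printing Implicit Defensive.

Import IntDist.

Record sgraph := SGraph {
  svertex :> finType;
  sedge : rel svertex;
  sedge_sym : symmetric sedge;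
  sedge_irrefl : irreflexive sedge }.

Definition edges (G : sgraph) : {set {set G}} :=
  [set e | [exists x : G, exists y : G, sedge x y && (e == [set x; y])]].

(* Subgraph containment, not necessarily induced. *)
Definition contains (G H : sgraph) : bool :=
  [exists f : {ffun H -> G},
    injectiveb f && [forall x, forall y, sedge x y ==> sedge (f x) (f y)]].

Definition isomorphic (G H : sgraph) : Prop :=
  exists2 f : G -> H, bijective f & {mono f : x y / sedge x y}.

Section GraphOfEdges.
Variables (T : finType) (S : {set {set T}}).

Definition edge_rel : rel T := fun x y => (x != y) && ([set x; y] \in S).

Fact edge_rel_sym : symmetric edge_rel.
Proof. by move=> x y; rewrite /edge_rel eq_sym setUC. Qed.

Fact edge_rel_irrefl : irreflexive edge_rel.
Proof. by move=> x; rewrite /edge_rel eqxx. Qed.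

(* Members of S that are not pairs are ignored; every simple graph on T has
   the form graph_of S for some S. *)
Definition graph_of : sgraph := SGraph edge_rel_sym edge_rel_irrefl.

End GraphOfEdges.

(* Every n-vertex graph is isomorphic to one on 'I_n, so the maximum is taken
   over the labelled graphs on 'I_n. *)
Definition ex (n : nat) (H : sgraph) : nat :=
  \max_(S : {set {set 'I_n}} | ~~ contains (graph_of S) H)
    #|edges (graph_of S)|.

Definition extremal (n : nat) (H G : sgraph) : Prop :=
  [/\ #|G| = n, ~~ contains G H & #|edges G| = ex n H].

Section PathSquare.
Variable k : nat.

Definition path_sq_rel : rel 'I_k := fun x y => 1 <= `|x - y| <= 2.

Fact path_sq_sym : symmetric path_sq_rel.
Proof. by move=> x y; rewrite /path_sq_rel distnC. Qed.

Fact path_sq_irrefl : irreflexive path_sq_rel.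
Proof. by move=> x; rewrite /path_sq_rel distnn. Qed.

Definition path_sq : sgraph := SGraph path_sq_sym path_sq_irrefl.

End PathSquare.

Section BipartitePlusMatching.
Variables n i : nat.

(* X = {0, ..., i-1} and Y = {i, ..., n-1}. The maximum matching of X consists
   of the pairs {2m, 2m+1} with 2m+1 < i. Intended for 1 <= i <= n-1. *)
Definition E_rel : rel 'I_n := fun x y =>
  ((x < i) (+) (y < i)) || [&& x < i, y < i, x != y & x./2 == y./2].

Fact E_sym : symmetric E_rel.
Proof.
move=> x y; rewrite /E_rel addbC eq_sym [_./2 == _]eq_sym.
by case: (x < i); case: (y < i).
Qed.

Fact E_irrefl : irreflexive E_rel.
Proof. by move=> x; rewrite /E_rel addbb eqxx /= !andbF. Qed.

Definition E_graph : sgraph := SGraph E_sym E_irrefl.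

End BipartitePlusMatching.

(* K_4 on {0, 1, 2, 3}, with 4 pendant at 0. *)
Definition G0_rel : rel 'I_5 := fun x y =>
  (x != y) && [|| (x < 4) && (y < 4), x == 0 :> nat | y == 0 :> nat].

Fact G0_sym : symmetric G0_rel.
Proof.
by move=> x y; rewrite /G0_rel eq_sym [(x < 4) && _]andbC (orbC (x == 0 :> nat)).
Qed.

Fact G0_irrefl : irreflexive G0_rel.
Proof. by move=> x; rewrite /G0_rel eqxx. Qed.

Definition G0 : sgraph := SGraph G0_sym G0_irrefl.

(* Main.v *)
(* P_5^2 is the join of a vertex (v_3) with the path v_1 v_2 v_4 v_5, so G is
   P_5^2-free iff no neighbourhood contains a path on four vertices. Hence a
   vertex outside a K_4 has at most one neighbour in it, and a vertex outside a
   diamond (the edge ab plus two non-adjacent common neighbours c, d) has its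
   neighbours in the diamond inside {a, b} or inside {c, d}. Deleting a K_4, a
   diamond, or, failing these, a triangle, and using Mantel's theorem for
   triangle-free graphs, gives by induction at most (n^2 + n) / 4 edges for
   n >= 5. For n >= 6 this can be attained only through a diamond each of whose
   outside vertices has exactly two neighbours in it. Then Y = N(a) & N(b) is
   independent (else there is a K_4), X = N(c) & N(d) induces a matching (a path
   x q r in X and c, d would make q the hub of a fan), X and Y partition the
   vertices, and counting forces all X-Y edges and a maximum matching in X. *)
Require Import Defs.
From mathcomp Require Import all_boot zify.

Set Implicit Arguments.
Unset Strict Implicit.
Unset Printing Implicit Defensive.

Implicit Types G H : sgraph.

(** * Fans, K_4, diamonds and triangles *)

(** The hub [h] plays the middle vertex of the squared path. Only non-consecutive path vertices get
    an explicit inequality; the other inequalities follow from adjacency. *)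
Definition fan_free G := forall h p q r s : G,
  sedge h p -> sedge h q -> sedge h r -> sedge h s ->
  sedge p q -> sedge q r -> sedge r s ->
  p != r -> p != s -> q != s -> False.

(* Twice the number of edges inside A. *)
Definition degsum G (A : {set G}) := \sum_(x in A) \sum_(y in A) sedge x y.

Definition is_K4 G (A : {set G}) (a b c d : G) :=
  all [in A] [:: a; b; c; d] &&
  [&& sedge a b, sedge a c, sedge a d, sedge b c, sedge b d & sedge c d].

(** Adjacency of [c] and [d] is left open, so a K_4 counts as a diamond, and excluding diamonds
    excludes K_4 as well. *)
Definition is_diamond G (A : {set G}) (a b c d : G) :=
  all [in A] [:: a; b; c; d] &&
  [&& sedge a b, sedge a c, sedge a d, sedge b c, sedge b d & c != d].

Definition is_triangle G (A : {set G}) (a b c : G) :=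
  all [in A] [:: a; b; c] && [&& sedge a b, sedge a c & sedge b c].

Definition K4_in G (A : {set G}) :=
  [exists a, exists b, exists c, exists d, is_K4 A a b c d].

Definition diamond_in G (A : {set G}) :=
  [exists a, exists b, exists c, exists d, is_diamond A a b c d].

Definition triangle_in G (A : {set G}) :=
  [exists a, exists b, exists c, is_triangle A a b c].

Lemma K4_inP G (A : {set G}) :
  reflect (exists a b c d, is_K4 A a b c d) (K4_in A).
Proof.
apply: (iffP existsP) => [[a /existsP[b /existsP[c /existsP[d abcd]]]]|].
  by exists a, b, c, d.
case=> a [b [c [d abcd]]]; exists a; apply/existsP; exists b.
by apply/existsP; exists c; apply/existsP; exists d.
Qed.

Lemma diamond_inP G (A : {set G}) :
  reflect (exists a b c d, is_diamond A a b c d) (diamond_in A).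
Proof.
apply: (iffP existsP) => [[a /existsP[b /existsP[c /existsP[d abcd]]]]|].
  by exists a, b, c, d.
case=> a [b [c [d abcd]]]; exists a; apply/existsP; exists b.
by apply/existsP; exists c; apply/existsP; exists d.
Qed.

Lemma triangle_inP G (A : {set G}) :
  reflect (exists a b c, is_triangle A a b c) (triangle_in A).
Proof.
apply: (iffP existsP) => [[a /existsP[b /existsP[c abc]]]|].
  by exists a, b, c.
case=> a [b [c abc]]; exists a; apply/existsP; exists b.
by apply/existsP; exists c.
Qed.

Lemma sedge_neq G (x y : G) : sedge x y -> x != y.
Proof. by apply: contraTneq => ->; rewrite sedge_irrefl. Qed.

(** * Degree sums under deletion of a few vertices *)

Lemma degsum_setD G (A B : {set G}) : B \subset A ->
  degsum A = degsum (A :\: B)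
             + (\sum_(x in A :\: B) \sum_(y in B) sedge x y) * 2 + degsum B.
Proof.
move=> /setIidPr AB; rewrite /degsum.
have split_sum (F : G -> nat) :
    \sum_(x in A) F x = \sum_(x in B) F x + \sum_(x in A :\: B) F x.
  by rewrite (big_setID B) /= AB.
rewrite split_sum.
under eq_bigr do rewrite split_sum.
under [X in _ + X]eq_bigr do rewrite split_sum.
rewrite !big_split /= [X in _ + X + _]exchange_big /=.
under [X in _ + X + _]eq_bigr do under eq_bigr do rewrite sedge_sym.
lia.
Qed.

Lemma degsum_split G (A : {set G}) (s : seq G) :
  uniq s -> {subset s <= A} ->
  degsum A = degsum (A :\: [set x in s])
             + (\sum_(x in A :\: [set x in s]) \sum_(y <- s) sedge x y) * 2
             + \sum_(x <- s) \sum_(y <- s) sedge x y.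
Proof.
move=> s_uniq sA; rewrite (@degsum_setD _ _ [set x in s]); last first.
  by apply/subsetP => x; rewrite inE => /sA.
have sumE (F : G -> nat) : \sum_(x in [set x in s]) F x = \sum_(x <- s) F x.
  by rewrite big_uniq //; apply: eq_bigl => x; rewrite inE.
rewrite /degsum sumE; under [X in _ + X]eq_bigr do rewrite sumE.
by under [X in _ + X * 2 + _]eq_bigr do rewrite sumE.
Qed.

Lemma card_peel G (A : {set G}) (s : seq G) :
  uniq s -> {subset s <= A} -> #|A :\: [set x in s]| + size s = #|A|.
Proof.
move=> s_uniq sA; rewrite -(cardsID [set x in s] A) (setIidPr _).
  rewrite addnC -(card_uniqP s_uniq); congr (_ + _).
  by apply: eq_card => x; rewrite inE.
by apply/subsetP => x; rewrite inE => /sA.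
Qed.

Lemma degsum_peel G (A : {set G}) (s : seq G) (k : nat) :
  uniq s -> {subset s <= A} ->
  (forall x, x \in A -> x \notin s -> \sum_(y <- s) sedge x y <= k) ->
  degsum A <= degsum (A :\: [set x in s]) + (#|A| - size s) * k * 2
              + \sum_(x <- s) \sum_(y <- s) sedge x y.
Proof.
move=> s_uniq sA s_k; rewrite (degsum_split s_uniq sA) leq_add2r leq_add2l.
rewrite leq_mul2r /=.
rewrite -(card_peel s_uniq sA) addnK.
rewrite -sum_nat_const; apply: leq_sum => x; rewrite !inE => /andP[xs xA].
exact: s_k.
Qed.

(** * Edges leaving a K_4, a diamond or a triangle *)

(** If [w] had two neighbours x, y in the K_4, with u, v the other two vertices, then x would be the
    hub over the path w, y, u, v. *)
Lemma K4_outside G (A : {set G}) a b c d w :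
  fan_free G -> is_K4 A a b c d -> w \notin [:: a; b; c; d] ->
  \sum_(y <- [:: a; b; c; d]) sedge w y <= 1.
Proof.
move=> ff /andP[_ /and5P[ab ac ad bc /andP[bd cd]]].
have [ba ca da] : [/\ sedge b a, sedge c a & sedge d a] by rewrite !(sedge_sym _ a).
have [cb db dc] : [/\ sedge c b, sedge d b & sedge d c].
  by rewrite !(sedge_sym _ b) (sedge_sym d c).
rewrite !inE !negb_or => /and4P[wa wb wc wd].
rewrite !big_cons big_nil.
have pair x y u v : sedge x y -> sedge x u -> sedge x v -> sedge y u ->
    sedge u v -> y != v -> w != u -> w != v -> ~~ (sedge w x && sedge w y).
  move=> xy xu xv yu uv yv wu wv; apply/andP => -[]; rewrite sedge_sym => xw wy.
  exact: (ff x w y u v).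
have := (pair a b c d ab ac ad bc cd (sedge_neq bd) wc wd).
have := (pair a c b d ac ab ad cb bd (sedge_neq cd) wb wd).
have := (pair a d b c ad ab ac db bc (sedge_neq dc) wb wc).
have := (pair b c a d bc ba bd ca ad (sedge_neq cd) wa wd).
have := (pair b d a c bd ba bc da ac (sedge_neq dc) wa wc).
have := (pair c d a b cd ca cb da ab (sedge_neq db) wa wb).
move: (sedge w a) (sedge w b) (sedge w c) (sedge w d).
by do 4!case.
Qed.

(** Let x, y be the ends of the central edge and u, v the two tips, each in either order. If [w] is
    adjacent to x and u, then x is the hub over the path w, u, y, v. *)
Lemma diamond_outside G (A : {set G}) a b c d w :
  fan_free G -> is_diamond A a b c d -> w \notin [:: a; b; c; d] ->
  [/\ ~~ (sedge w a && sedge w c), ~~ (sedge w a && sedge w d),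
      ~~ (sedge w b && sedge w c) & ~~ (sedge w b && sedge w d)].
Proof.
move=> ff /andP[_ /and5P[ab ac ad bc /andP[bd cd]]].
have [ba ca da] : [/\ sedge b a, sedge c a & sedge d a] by rewrite !(sedge_sym _ a).
have [cb db] : sedge c b /\ sedge d b by rewrite !(sedge_sym _ b).
rewrite !inE !negb_or => /and4P[wa wb wc wd].
have pair x y u v : sedge x y -> sedge x u -> sedge x v -> sedge y u ->
    sedge y v -> u != v -> w != y -> w != v -> ~~ (sedge w x && sedge w u).
  move=> xy xu xv yu yv uv wy wv; apply/andP => -[]; rewrite sedge_sym => xw wu.
  by apply: (ff x w u y v); rewrite // (sedge_sym u).
by split; [apply: (pair a b c d) | apply: (pair a b d c)
          | apply: (pair b a c d) | apply: (pair b a d c)]; rewrite // eq_sym.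
Qed.

Lemma diamond_outside_sum G (A : {set G}) a b c d w :
  fan_free G -> is_diamond A a b c d -> w \notin [:: a; b; c; d] ->
  \sum_(y <- [:: a; b; c; d]) sedge w y <= 2.
Proof.
move=> ff abcd w_out; rewrite !big_cons big_nil.
have [] := diamond_outside ff abcd w_out.
by case: (sedge w a); case: (sedge w b); case: (sedge w c); case: (sedge w d).
Qed.

Lemma uniq_K4 G (A : {set G}) a b c d : is_K4 A a b c d -> uniq [:: a; b; c; d].
Proof.
case/andP=> _ /and5P[ab ac ad bc /andP[bd cd]].
by rewrite /= !inE !negb_or !sedge_neq.
Qed.

Lemma uniq_diamond G (A : {set G}) a b c d :
  is_diamond A a b c d -> uniq [:: a; b; c; d].
Proof.
case/andP=> _ /and5P[ab ac ad bc /andP[bd cd]].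
by rewrite /= !inE !negb_or cd !sedge_neq.
Qed.

Lemma K4_in_sub G (A B : {set G}) : A \subset B -> K4_in A -> K4_in B.
Proof.
move=> /subsetP AB /K4_inP[a [b [c [d /andP[abcdA ?]]]]].
apply/K4_inP; exists a, b, c, d; apply/andP; split=> //.
by apply: sub_all abcdA => x /AB.
Qed.

Lemma degsum_K4_split G (A : {set G}) a b c d :
  is_K4 A a b c d -> let s := [:: a; b; c; d] in
  degsum A = degsum (A :\: [set x in s])
             + (\sum_(x in A :\: [set x in s]) \sum_(y <- s) sedge x y) * 2 + 12.
Proof.
move=> K /=; have /andP[/allP sA Ke] := K.
rewrite (degsum_split (uniq_K4 K) sA); congr (_ + _).
rewrite !big_cons !big_nil !sedge_irrefl.
rewrite (sedge_sym b a) (sedge_sym c a) (sedge_sym d a).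
rewrite (sedge_sym c b) (sedge_sym d b) (sedge_sym d c).
by case/and5P: Ke => -> -> -> -> /andP[-> ->].
Qed.

Lemma degsum_K4 G (A : {set G}) a b c d :
  fan_free G -> is_K4 A a b c d ->
  degsum A <= degsum (A :\: [set x in [:: a; b; c; d]]) + (#|A| - 4) * 2 + 12.
Proof.
move=> ff K; have /andP[/allP sA _] := K.
rewrite (degsum_K4_split K) leq_add2r leq_add2l leq_mul2r /=.
rewrite -(card_peel (uniq_K4 K) sA) addnK -[leqRHS]muln1 -sum_nat_const.
apply: leq_sum => x; rewrite !inE => /andP[xs _].
by apply: K4_outside K _; rewrite // !inE.
Qed.

Lemma degsum_diamond_split G (A : {set G}) a b c d :
  ~~ K4_in A -> is_diamond A a b c d -> let s := [:: a; b; c; d] in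
  degsum A = degsum (A :\: [set x in s])
             + (\sum_(x in A :\: [set x in s]) \sum_(y <- s) sedge x y) * 2 + 10.
Proof.
move=> noK4 D /=; have /andP[/allP sA De] := D.
have cd0 : sedge c d = false.
  apply: contraNF noK4 => cd; apply/K4_inP; exists a, b, c, d.
  apply/andP; split; first by apply/allP.
  by case/and5P: De => -> -> -> -> /andP[-> _].
rewrite (degsum_split (uniq_diamond D) sA); congr (_ + _).
rewrite !big_cons !big_nil !sedge_irrefl.
rewrite (sedge_sym b a) (sedge_sym c a) (sedge_sym d a).
rewrite (sedge_sym c b) (sedge_sym d b) (sedge_sym d c) cd0.
by case/and5P: De => -> -> -> -> /andP[-> _].
Qed.

Lemma degsum_diamond G (A : {set G}) a b c d :
  fan_free G -> ~~ K4_in A -> is_diamond A a b c d ->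
  degsum A <= degsum (A :\: [set x in [:: a; b; c; d]]) + (#|A| - 4) * 4 + 10.
Proof.
move=> ff noK4 D; have /andP[/allP sA _] := D.
rewrite (degsum_diamond_split noK4 D) leq_add2r leq_add2l.
have -> : (#|A| - 4) * 4 = (#|A| - 4) * 2 * 2 by lia.
rewrite leq_mul2r /=.
rewrite -(card_peel (uniq_diamond D) sA) addnK -sum_nat_const.
apply: leq_sum => x; rewrite !inE => /andP[xs _].
by apply: diamond_outside_sum D _; rewrite // !inE.
Qed.

(** An outside vertex with two neighbours in the triangle would complete a diamond, so each one
    sends at most one edge to it. *)
Lemma degsum_triangle G (A : {set G}) a b c :
  ~~ diamond_in A -> is_triangle A a b c ->
  degsum A <= degsum (A :\: [set x in [:: a; b; c]]) + (#|A| - 3) * 2 + 6.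
Proof.
move=> noD /andP[/allP sA /and3P[ab ac bc]].
apply: leq_trans (degsum_peel (k := 1) _ sA _) _.
- by rewrite /= !inE !negb_or (sedge_neq ab) (sedge_neq ac) (sedge_neq bc).
- move=> w wA; rewrite !inE !negb_or !big_cons big_nil => /and3P[wa wb wc].
  have [aA bA cA] : [/\ a \in A, b \in A & c \in A].
    by rewrite !sA // !inE eqxx ?orbT.
  have pair x y z : x \in A -> y \in A -> z \in A -> sedge x y -> sedge x z ->
      sedge y z -> w != z -> ~~ (sedge w x && sedge w y).
    move=> xA yA zA xy xz yz wz; apply: contra noD => /andP[wx wy].
    apply/diamond_inP; exists x, y, w, z; rewrite /is_diamond /= xA yA zA wA.
    by rewrite xy xz yz wz !(sedge_sym _ w) wx wy.
  have := pair a b c aA bA cA ab ac bc wc.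
  have := pair a c b aA cA bA ac ab; rewrite (sedge_sym c b) => /(_ bc wb).
  have := pair b c a bA cA aA bc; rewrite (sedge_sym b a) (sedge_sym c a) => /(_ ab ac wa).
  by case: (sedge w a); case: (sedge w b); case: (sedge w c).
rewrite muln1 leq_add2l !big_cons !big_nil !sedge_irrefl.
by rewrite (sedge_sym b a) (sedge_sym c a) (sedge_sym c b) ab ac bc.
Qed.

(** * Upper bounds on the degree sum *)

(** Induction by deleting both ends of an edge: without triangles, every other vertex is adjacent to
    at most one of them. *)
Lemma mantel G (A : {set G}) : ~~ triangle_in A -> degsum A * 2 <= #|A| ^ 2.
Proof.
have [n] := ubnP #|A|; elim: n A => // n IHn A leAn noT.
have [/existsP[x /existsP[y /and3P[xA yA xy]]]|no_edge] :=
  boolP [exists x, exists y, [&& x \in A, y \in A & sedge x y]]; last first.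
  rewrite /degsum big1 // => x xA; rewrite big1 // => y yA.
  apply/eqP; rewrite eqb0; apply: contra no_edge => xy.
  by apply/existsP; exists x; apply/existsP; exists y; rewrite xA yA.
have xyU : uniq [:: x; y] by rewrite /= inE sedge_neq.
have sA : {subset [:: x; y] <= A}.
  by move=> z; rewrite !inE => /orP[]/eqP->.
have cardA := card_peel xyU sA.
have := degsum_peel (k := 1) xyU sA.
set B := A :\: _ in cardA *.
have {}IHn : degsum B * 2 <= #|B| ^ 2.
  apply: IHn; first by move: cardA leAn => /=; lia.
  apply: contra noT => /triangle_inP[a [b [c /andP[/allP abcB abc]]]].
  apply/triangle_inP; exists a, b, c; rewrite /is_triangle abc andbT.
  by apply/allP => z /abcB; rewrite !inE => /andP[].
rewrite !big_cons !big_nil !sedge_irrefl (sedge_sym y) xy /= => peel.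
have {peel} : degsum A <= degsum B + (#|A| - 2) * 1 * 2 + 2.
  apply: peel => z zA zxy; rewrite !big_cons big_nil.
  suff : ~~ (sedge z x && sedge z y) by do 2!case: (sedge z _).
  apply: contra noT => /andP[zx zy]; apply/triangle_inP; exists x, y, z.
  by rewrite /is_triangle /= xA yA zA xy !(sedge_sym _ z) zx zy.
move: cardA => /=; nia.
Qed.

(** With n = |A|, the bound (n^2 + n) / 2 on the degree sum grows by exactly 4n - 6 from n - 4 to n,
    which is what a diamond contributes at most, so that step is tight. From n - 3 to n it grows by
    3n - 3, while a triangle contributes at most 2n. *)
Lemma degsum_K4_free G (A : {set G}) :
  fan_free G -> ~~ K4_in A -> degsum A * 2 <= #|A| ^ 2 + #|A|.
Proof.
move=> ff; have [n] := ubnP #|A|; elim: n A => // n IHn A leAn noK4.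
have [/diamond_inP[a [b [c [d D]]]]|noD] := boolP (diamond_in A).
  have /andP[/allP sA _] := D; have cardA := card_peel (uniq_diamond D) sA.
  have := degsum_diamond ff noK4 D; set B := A :\: _ in cardA *.
  have : degsum B * 2 <= #|B| ^ 2 + #|B|.
    apply: IHn; first by move: cardA leAn => /=; lia.
    by apply: contra noK4; apply: K4_in_sub; apply: subsetDl.
  move: cardA => /=; nia.
have [/triangle_inP[a [b [c D]]]|noT] := boolP (triangle_in A); last first.
  by have := mantel noT; nia.
have /andP[/allP sA /and3P[ab ac bc]] := D.
have abcU : uniq [:: a; b; c] by rewrite /= !inE !negb_or !sedge_neq.
have cardA := card_peel abcU sA.
have := degsum_triangle noD D; set B := A :\: _ in cardA *.
have : degsum B * 2 <= #|B| ^ 2 + #|B|.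
  apply: IHn; first by move: cardA leAn => /=; lia.
  by apply: contra noK4; apply: K4_in_sub; apply: subsetDl.
move: cardA => /=; nia.
Qed.

(* The correction term accounts for K_4 itself, which exceeds the bound. *)
Lemma degsum_fan_free G (A : {set G}) :
  fan_free G -> degsum A * 2 <= #|A| ^ 2 + #|A| + (#|A| == 4) * 4.
Proof.
move=> ff; have [n] := ubnP #|A|; elim: n A => // n IHn A leAn.
have [/K4_inP[a [b [c [d K]]]]|/(degsum_K4_free ff)] := boolP (K4_in A); last first.
  by move=> h; apply: leq_trans h (leq_addr _ _).
have /andP[/allP sA _] := K; have cardA := card_peel (uniq_K4 K) sA.
have := degsum_K4 ff K; set B := A :\: _ in cardA *.
have : degsum B * 2 <= #|B| ^ 2 + #|B| + (#|B| == 4) * 4.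
  by apply: IHn; move: cardA leAn => /=; lia.
(* The correction term is nonzero for [A] when [B] is empty, and for the bound on [B] when |B| = 4;
   elsewhere it vanishes. *)
have [B0|[B4|]] : #|B| = 0 \/ #|B| = 4 \/ (#|B| <> 0 /\ #|B| <> 4) by lia.
- by move: cardA; rewrite B0 => <- /=; lia.
- by move: cardA; rewrite B4 => <- /=; lia.
move=> [/eqP B0 /eqP B4]; rewrite (negPf B4) -cardA /=.
by move: B0; case: eqP => /=; nia.
Qed.

(** * Structure of graphs that nearly attain the bound *)

(** This turns a tight total count into information on each vertex, first for the edges into a
    diamond and later for those between X and Y. *)
Lemma sum_nat_max_eq (I : finType) (B : {set I}) (F : I -> nat) c :
  {in B, forall x, F x <= c} -> #|B| * c <= \sum_(x in B) F x ->
  {in B, forall x, F x = c}.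
Proof.
move=> Fc; rewrite -sum_nat_const => cF x xB.
have := leqif_sum (fun x (xB : x \in B) => leqif_eq (Fc x xB)).
by case=> _; rewrite eqn_leq cF andbT leq_sum // => /esym/forall_inP/(_ x xB)/eqP.
Qed.

Definition matching G (X : {set G}) :=
  {in X & &, forall x y z, sedge x y -> sedge x z -> y = z}.

(** The slack 2 allows for the rounding in [(n ^ 2 + n) %/ 4], since n^2 + n is even. *)
Lemma near_extremal_cases G :
  fan_free G -> 5 <= #|G| -> #|G| ^ 2 + #|G| <= degsum [set: G] * 2 + 2 ->
  #|G| = 5 /\ K4_in [set: G] \/
  exists X : {set G}, matching X /\ {in ~: X &, forall x y, ~~ sedge x y}.
Proof.
move=> ff G5; rewrite -cardsT in G5 *; move=> near.
have [/K4_inP[a [b [c [d K]]]]|noK4] := boolP (K4_in [set: G]).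
  have /andP[/allP sA _] := K; have cardA := card_peel (uniq_K4 K) sA.
  have := degsum_K4 ff K; set B := _ :\: _ in cardA *.
  have := degsum_fan_free B ff => degB degG.
  left; split=> //.
  (* With b = |B| different from 4, twice the degree sum is at most b^2 + 5b + 24 but must be at
     least b^2 + 9b + 18, so b = 1. For b = 4 the correction term enters, and the count still
     fails. *)
  have [B1|[B4|[B14]]] : #|B| = 1 \/ #|B| = 4 \/ 1 < #|B| /\ #|B| <> 4.
    by move: cardA => /=; lia.
  - by rewrite -cardA B1.
  - by move: near degG degB; rewrite -cardA B4 /=; lia.
  move=> /eqP B4; move: near degG degB; rewrite (negPf B4) -cardA /=; nia.
have [/diamond_inP[a [b [c [d D]]]]|noD] := boolP (diamond_in [set: G]);
  last first.
  (* Twice the degree sum is at most n^2 - n + 6 with a triangle and n^2 without; both are below n^2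
     + n - 2 for n >= 5. *)
  have [/triangle_inP[a [b [c abc]]]|/mantel] := boolP (triangle_in [set: G]);
    last by nia.
  have /andP[/allP sA /and3P[ab ac bc]] := abc.
  have abcU : uniq [:: a; b; c] by rewrite /= !inE !negb_or !sedge_neq.
  have cardA := card_peel abcU sA.
  have := degsum_triangle noD abc; set B := _ :\: _ in cardA *.
  have : degsum B * 2 <= #|B| ^ 2 + #|B|.
    apply: degsum_K4_free => //.
    by apply: contra noK4; apply: K4_in_sub; apply: subsetDl.
  move: cardA near G5 => /=; nia.
right.
(* As the diamond step is tight, one missing edge into the diamond costs 4 in twice the degree sum,
   more than the slack 2. *)
have outside w : w \notin [:: a; b; c; d] ->
    \sum_(y <- [:: a; b; c; d]) sedge w y = 2.
  move=> w_out; have /andP[/allP sA _] := D.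
  have cardA := card_peel (uniq_diamond D) sA.
  have degG := degsum_diamond_split noK4 D.
  set B := _ :\: _ in cardA; rewrite /= -/B in degG.
  have degB : degsum B * 2 <= #|B| ^ 2 + #|B|.
    apply: degsum_K4_free => //.
    by apply: contra noK4; apply: K4_in_sub; apply: subsetDl.
  apply: (@sum_nat_max_eq _ B
    (fun w => \sum_(y <- [:: a; b; c; d]) (sedge w y : nat))).
  - move=> x; rewrite inE => /andP[xs _].
    by apply: diamond_outside_sum D _; move: xs; rewrite // !inE.
  - by move: near; rewrite degG -cardA /=; nia.
  - by rewrite inE in_setT andbT inE.
have /andP[_ /and5P[ab ac ad bc /andP[bd cd]]] := D.
have cd0 : sedge c d = false.
  apply: contraNF noK4 => cd'; apply/K4_inP; exists a, b, c, d.
  by rewrite /is_K4 /= !in_setT ab ac ad bc bd.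
(* An outside vertex sees exactly {a, b} or exactly {c, d}. The diamond fits the same pattern: [a],
   [b] lie in N(c), while [c], [d] do not. *)
have key x : (sedge d x = sedge c x) /\ (~~ sedge c x -> sedge a x && sedge b x).
  have [|x_out] := boolP (x \in [:: a; b; c; d]).
    rewrite !inE => /or4P[]/eqP->.
    - by rewrite !(sedge_sym _ a) ac ad.
    - by rewrite !(sedge_sym _ b) bc bd.
    - by rewrite (sedge_sym d c) cd0 ac bc sedge_irrefl.
    - by rewrite cd0 ad bd sedge_irrefl.
  have [] := diamond_outside ff D x_out; have := outside x x_out.
  rewrite !big_cons big_nil !(sedge_sym _ x).
  by case: (sedge x a); case: (sedge x b); case: (sedge x c); case: (sedge x d).
(* By [key], N(c) = N(d) and the complement of N(c) lies in both N(a) and N(b). *)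
exists [set x | sedge c x]; split=> [x y z|x y]; rewrite !inE => cx cy.
  move=> cz xy xz; case: (eqVneq y z) => // yz; exfalso.
  have [dx dy dz] : [/\ sedge d x, sedge d y & sedge d z].
    by rewrite (key x).1 (key y).1 (key z).1.
  apply: (ff x y c z d); rewrite // 1?(sedge_sym _ c) 1?(sedge_sym _ d) //.
  by apply: contraTneq cy => ->; rewrite cd0.
apply: contra noK4 => xy; apply/K4_inP; exists a, b, x, y.
have [_ /(_ cx)/andP[ax bx]] := key x; have [_ /(_ cy)/andP[ay by_]] := key y.
by rewrite /is_K4 /= !in_setT ab ax ay bx by_.
Qed.

(* With k = j - i, the slack 4 (j i - M) + 2 (i - D) is at most 2 - (k^2 + k),
   and k^2 + k is nonnegative for every integer k. *)
Lemma near_max_slack i j M D :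
  (i + j) ^ 2 + (i + j) <= (0 + M * 2 + D) * 2 + 2 -> M <= j * i -> D <= i ->
  j * i <= M /\ i <= D + 1.
Proof.
move=> near leM leD; have [ij|/ltnW ij] := leqP i j.
  move: near leM leD; rewrite -(subnKC ij); move: (j - i) => k.
  by split; nia.
(* With the sign reversed the expression is k^2 - k, so over the naturals k = 0 is treated apart. *)
move: near leM leD; rewrite -(subnKC ij); move: (i - j) => k; case: k => [|k].
  by split; nia.
by split; nia.
Qed.

(** Counting edges across and inside [X] forces every cross edge and leaves at most one unmatched
    vertex in [X]. The second conclusion expresses in this way that the matching is maximum. *)
Lemma near_extremal_structure G (X : {set G}) :
  #|G| ^ 2 + #|G| <= degsum [set: G] * 2 + 2 ->
  matching X -> {in ~: X &, forall x y, ~~ sedge x y} ->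
  {in X & ~: X, forall x y, sedge x y} /\
  {in X &, forall x y, {in X, forall z, ~~ sedge x z} ->
                       {in X, forall z, ~~ sedge y z} -> x = y}.
Proof.
move=> near mX iY; rewrite -(cardsC X) in near.
have degX1 : {in X, forall x, \sum_(y in X) sedge x y <= 1}.
  move=> x xX; have [/existsP[y /andP[yX xy]]|no_y] :=
    boolP [exists y, (y \in X) && sedge x y].
    rewrite (bigD1 y) //= xy big1 // => z /andP[zX zy]; apply/eqP.
    by rewrite eqb0; apply: contra zy => xz; apply/eqP; apply: (mX x).
  rewrite big1 // => y yX; apply/eqP; rewrite eqb0.
  by apply: contra no_y => xy; apply/existsP; exists y; rewrite yX.
have degE := degsum_setD (subsetT X); rewrite setTD in degE.
have degY : degsum (~: X) = 0.
  rewrite /degsum big1 // => x xY; rewrite big1 // => y yY.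
  by apply/eqP; rewrite eqb0 iY.
have degX : degsum X <= #|X|.
  by rewrite -sum1_card; apply: leq_sum.
have rowY : {in ~: X, forall x, \sum_(y in X) sedge x y <= #|X|}.
  by move=> x _; rewrite -sum1_card; apply: leq_sum => y _; case: (sedge x y).
set M := \sum_(x in ~: X) \sum_(y in X) sedge x y in degE.
have leM : M <= #|~: X| * #|X|.
  by rewrite -sum_nat_const; apply: leq_sum.
have [geM geX] : #|~: X| * #|X| <= M /\ #|X| <= degsum X + 1.
  by apply: near_max_slack leM degX; move: near; rewrite degE degY.
split=> [x y xX yY|x y xX yX x0 y0].
  have rowE := sum_nat_max_eq rowY geM yY.
  rewrite sedge_sym; apply/negPn/negP => yx.
  have : \sum_(z in X) sedge y z < #|X|.
    rewrite -sum1_card [ltnLHS](bigD1 x) // [ltnRHS](bigD1 x) //= (negPf yx).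
    by rewrite add0n add1n ltnS; apply: leq_sum => z _; case: (sedge y z).
  by rewrite rowE ltnn.
(* Two distinct unmatched vertices would bring the degree sum of [X] down to |X| - 2. *)
case: (eqVneq x y) => // xy; move: geX; rewrite -sum1_card /degsum.
have yXx : (y \in X) && (y != x) by rewrite yX eq_sym.
rewrite [leqLHS](bigD1 x) // [X in _ + X <= _](bigD1 y) //=.
rewrite [X in _ <= X + 1](bigD1 x) // [X in _ <= _ + X + 1](bigD1 y) //=.
have -> : \sum_(z in X) sedge x z = 0.
  by rewrite big1 // => z zX; apply/eqP; rewrite eqb0 x0.
have -> : \sum_(z in X) sedge y z = 0.
  by rewrite big1 // => z zX; apply/eqP; rewrite eqb0 y0.
rewrite !add0n !add1n addn1 !ltnS leqNgt => /negP[].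
rewrite ltnS; apply: leq_sum => z /andP[/andP[zX _] _]; exact: degX1.
Qed.

(** * Recognising E^i_n and G_0 up to isomorphism *)

(** Matched pairs are put in front one by one, so they occupy positions 2m and 2m + 1 as in [E_rel];
    a possible unmatched vertex comes last. *)
Lemma matching_enum G (X : {set G}) :
  matching X ->
  {in X &, forall x y, {in X, forall z, ~~ sedge x z} ->
                       {in X, forall z, ~~ sedge y z} -> x = y} ->
  exists s : seq G, [/\ uniq s, s =i X &
    forall x0 j k, j < size s -> k < size s ->
      sedge (nth x0 s j) (nth x0 s k) = (j != k) && (j./2 == k./2)].
Proof.
have [n] := ubnP #|X|; elim: n X => // n IHn X leXn mX one.
have [/existsP[x /existsP[y /and3P[xX yX xy]]]|no_edge] :=
  boolP [exists x, exists y, [&& x \in X, y \in X & sedge x y]]; last first.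
  have isolated : {in X &, forall x y, ~~ sedge x y}.
    move=> x y xX yX; apply: contra no_edge => xy.
    by apply/existsP; exists x; apply/existsP; exists y; rewrite xX yX.
  exists (enum X); split=> [|x|x0 j k]; rewrite ?enum_uniq ?mem_enum //.
  have le1 : #|X| <= 1.
    apply/card_le1_eqP => x y xX yX.
    by apply: one => // z zX; apply: isolated.
  rewrite -cardE => jX kX; have [-> ->] : j = 0 /\ k = 0 by lia.
  by rewrite sedge_irrefl.
have neq_xy := sedge_neq xy.
have yx : sedge y x by rewrite sedge_sym.
have subX z : z \in X :\ x :\ y -> [/\ z \in X, z != x & z != y].
  by rewrite !inE => /and3P[].
have [|||s [s_uniq sX s_edge]] := IHn (X :\ x :\ y).
- move: leXn; rewrite (cardsD1 x X) xX (cardsD1 y (X :\ x)) !inE yX eq_sym neq_xy.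
  lia.
- by move=> u v w /subX[? _ _] /subX[? _ _] /subX[? _ _]; apply: mX.
- move=> u v /subX[uX ux uy] /subX[vX vx vy].
  (* Since [x] and [y] are matched to each other, a vertex unmatched after their removal is already
     unmatched in [X]. *)
  have extend w : w \in X -> w != x -> w != y ->
      {in X :\ x :\ y, forall z, ~~ sedge w z} -> {in X, forall z, ~~ sedge w z}.
    move=> wX wx wy w0 z zX; have [->|zx] := eqVneq z x.
      apply: contra wy; rewrite sedge_sym => xw.
      by apply/eqP; apply: (mX x).
    have [->|zy] := eqVneq z y.
      apply: contra wx; rewrite sedge_sym => yw.
      by apply/eqP; apply: (mX y).
    by apply: w0; rewrite !inE zx zy.
  by move=> u0 v0; apply: one => //; apply: extend.
have s_out z : z \in s -> [/\ z \in X, z != x & z != y] by rewrite sX => /subX.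
have xs z : z \in s -> sedge x z = false.
  move=> /s_out[zX zx zy]; apply: contraNF zy => xz.
  by apply/eqP; apply: (mX x).
have ys z : z \in s -> sedge y z = false.
  move=> /s_out[zX zx zy]; apply: contraNF zx => yz.
  by apply/eqP; apply: (mX y).
exists [:: x, y & s]; split.
- rewrite /= inE negb_or neq_xy s_uniq andbT /=.
  by apply/andP; split; apply/negP => /s_out[]; rewrite eqxx.
- move=> z; rewrite !inE sX !inE.
  have [->|zx] := eqVneq z x; first by rewrite xX.
  by have [->|zy] := eqVneq z y; first by rewrite yX.
move=> x0 [|[|j]] [|[|k]] /=; rewrite ?sedge_irrefl ?xy ?yx // !ltnS => lej lek.
- by rewrite xs ?mem_nth.
- by rewrite ys ?mem_nth.
- by rewrite sedge_sym xs ?mem_nth.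
- by rewrite sedge_sym ys ?mem_nth.
- by rewrite s_edge.
Qed.

(** A duplicate-free list of full length contains every vertex, so the position in [s] is a
    bijection. *)
Lemma isomorphic_of_seq G n (e : rel 'I_n) e_sym e_irr (s : seq G) :
  uniq s -> size s = n -> #|G| = n ->
  (forall x0 (j k : 'I_n), sedge (nth x0 s j) (nth x0 s k) = e j k) ->
  isomorphic G (@SGraph _ e e_sym e_irr).
Proof.
move=> s_uniq sizes cardG s_edge.
have s_all x : x \in s.
  have [||_ ->] := uniq_min_size (s2 := enum G) s_uniq; last by rewrite mem_enum.
  - by move=> z _; rewrite mem_enum.
  - by rewrite -cardE cardG sizes.
have idx x : index x s < n by rewrite -sizes index_mem.
exists (fun x => Ordinal (idx x)).
  apply: inj_card_bij => [x y /(congr1 val) /= eq_idx|].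
    by rewrite -(nth_index x (s_all x)) eq_idx nth_index.
  by rewrite card_ord cardG.
move=> x y /=; rewrite -(s_edge x) /= !nth_index //.
Qed.

Lemma isomorphic_E_graph G (X : {set G}) :
  matching X -> {in ~: X &, forall x y, ~~ sedge x y} ->
  {in X & ~: X, forall x y, sedge x y} ->
  {in X &, forall x y, {in X, forall z, ~~ sedge x z} ->
                       {in X, forall z, ~~ sedge y z} -> x = y} ->
  isomorphic G (E_graph #|G| #|X|).
Proof.
move=> mX iY XY one; have [s [s_uniq sX s_edge]] := matching_enum mX one.
have sizes : size s = #|X|.
  by rewrite -(card_uniqP s_uniq); apply: eq_card.
have card_sum : size (s ++ enum (~: X)) = #|G|.
  by rewrite size_cat sizes -cardE cardsC.
apply: (@isomorphic_of_seq _ _ _ _ _ (s ++ enum (~: X))) => //.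
  rewrite cat_uniq s_uniq enum_uniq andbT /=.
  by apply/hasPn => x; rewrite mem_enum inE [x \in mem s]sX.
move=> x0 j k; rewrite /E_rel !nth_cat sizes.
have inX l : l < #|X| -> nth x0 s l \in X.
  by move=> lX; rewrite -sX mem_nth // sizes.
have inY (l : 'I_#|G|) : #|X| <= l -> nth x0 (enum (~: X)) (l - #|X|) \in ~: X.
  move=> lX; rewrite -mem_enum mem_nth // -cardE.
  by rewrite -(ltn_add2l #|X|) subnKC // cardsC ltn_ord.
case: (ltnP j #|X|) => jX; case: (ltnP k #|X|) => kX /=.
- by rewrite s_edge ?sizes.
- by rewrite XY ?inX ?inY.
- by rewrite sedge_sym XY ?inX ?inY.
- by apply/negbTE/iY; apply: inY.
Qed.

Lemma isomorphic_G0 G a b c d w :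
  #|G| = 5 -> is_K4 [set: G] a b c d -> w \notin [:: a; b; c; d] ->
  sedge w a -> ~~ sedge w b -> ~~ sedge w c -> ~~ sedge w d ->
  isomorphic G G0.
Proof.
move=> G5 K w_out wa /negPf wb /negPf wc /negPf wd.
(* In [G0] the pendant vertex 4 hangs at 0, hence [a] first and [w] last. *)
apply: (@isomorphic_of_seq _ _ _ _ _ [:: a; b; c; d; w]) => //.
  by rewrite -[_ :: _]/(rcons [:: a; b; c; d] w) rcons_uniq w_out (uniq_K4 K).
move=> x0 [j ltj5] [k ltk5]; case/andP: K => _ /and5P[ab ac ad bc /andP[bd cd]].
move: j k ltj5 ltk5.
move=> [|[|[|[|[|//]]]]] [|[|[|[|[|//]]]]] lej lek;
  rewrite /= ?sedge_irrefl ?(sedge_sym b a) ?(sedge_sym c a) ?(sedge_sym d a)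
    ?(sedge_sym c b) ?(sedge_sym d b) ?(sedge_sym d c)
    ?(sedge_sym _ w) ?wa ?wb ?wc ?wd //.
Qed.

(** The K_4 accounts for 12 of the degree sum, so the fifth vertex sends at least one edge to it,
    and by [K4_outside] exactly one. *)
Lemma extremal5_K4 G :
  fan_free G -> #|G| = 5 -> 14 <= degsum [set: G] -> K4_in [set: G] ->
  isomorphic G G0.
Proof.
move=> ff G5 degG /K4_inP[a [b [c [d K]]]].
have /andP[/allP sA _] := K; have cardA := card_peel (uniq_K4 K) sA.
have := degsum_K4_split K; rewrite /= => degE.
have /cards1P[w wE] : #|[set: G] :\: [set x in [:: a; b; c; d]]| == 1.
  by move: cardA; rewrite cardsT G5 /=; lia.
have : w \in [set: G] :\: [set x in [:: a; b; c; d]] by rewrite wE inE.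
rewrite inE in_setT andbT inE => w_out.
have := K4_outside ff K w_out.
move: degG; rewrite degE wE /degsum !big_set1 sedge_irrefl !big_cons big_nil.
have /andP[_ /and5P[ab ac ad bc /andP[bd cd]]] := K.
(* The K_4 is relabelled so that the neighbour of [w] comes first. *)
have swap x y z t : w \notin [:: x; y; z; t] -> sedge w x -> ~~ sedge w y ->
    ~~ sedge w z -> ~~ sedge w t -> is_K4 [set: G] x y z t -> isomorphic G G0.
  by move=> w_out' wx wy wz wt K'; apply: (isomorphic_G0 G5 K' w_out').
have := swap a b c d w_out.
have := swap b a c d; have := swap c a b d; have := swap d a b c.
rewrite /is_K4 /= !in_setT ab ac ad bc bd cd !(sedge_sym b a) !(sedge_sym c a).
rewrite !(sedge_sym d a) !(sedge_sym c b) !(sedge_sym d b) !(sedge_sym d c).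
rewrite ab ac ad bc bd cd /=.
move: w_out; rewrite !inE !negb_or => /and4P[-> -> -> ->].
by case: (sedge w a); case: (sedge w b); case: (sedge w c); case: (sedge w d);
  move=> Hd Hc Hb Ha // _ // _;
  first [by apply: Ha | by apply: Hb | by apply: Hc | by apply: Hd].
Qed.

(** * Edge counts, isomorphism invariance and the squared path as a fan *)

(** Handshake lemma: the ordered adjacent pairs are partitioned by their underlying edge, and each
    class has two members. *)
Lemma degsum_edges G : degsum [set: G] = #|edges G| * 2.
Proof.
pose arcs := [set p : G * G | sedge p.1 p.2].
have -> : degsum [set: G] = #|arcs|.
  rewrite -sum1_card /degsum pair_big /= [RHS]big_mkcond /=.
  by rewrite [LHS]big_mkcond /=; apply: eq_bigr => p _; rewrite !inE; case: sedge.
pose pair_of (p : G * G) := [set p.1; p.2].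
rewrite -sum1_card (partition_big pair_of [in edges G]) /=; last first.
  move=> [x y]; rewrite !inE /= => xy.
  by apply/existsP; exists x; apply/existsP; exists y; rewrite xy eqxx.
rewrite -sum_nat_const; apply: eq_bigr => E.
rewrite inE => /existsP[x /existsP[y /andP[xy /eqP->]]].
rewrite sum1dep_card.
have <- : #|[set (x, y); (y, x)]| = 2.
  by rewrite cards2 xpair_eqE negb_and sedge_neq.
apply: eq_card => -[u v]; rewrite !inE /= !xpair_eqE /pair_of /=.
apply/andP/orP => [[uv /eqP/setP uvE]|].
  have := uvE u; have := uvE v; have := sedge_neq uv; rewrite !inE !eqxx orbT /=.
  by move=> neq_uv /esym/orP[]/eqP ? /esym/orP[]/eqP ?; subst u v;
     rewrite ?eqxx ?orbT // in neq_uv *; auto.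
by case=> /andP[/eqP-> /eqP->]; rewrite ?(sedge_sym y) xy // setUC.
Qed.

Lemma isomorphic_card G H : isomorphic G H -> #|G| = #|H|.
Proof. by case=> f /bij_eq_card. Qed.

Lemma isomorphic_edges G H : isomorphic G H -> #|edges G| = #|edges H|.
Proof.
case=> f f_bij f_edge; suff : degsum [set: G] = degsum [set: H].
  by rewrite !degsum_edges; lia.
have sumE (F : H -> nat) : \sum_(y in [set: H]) F y = \sum_(x in [set: G]) F (f x).
  rewrite (reindex f) /=; last by apply: onW_bij.
  by apply: eq_bigl => x; rewrite !inE.
rewrite /degsum sumE; apply: eq_bigr => x _.
by rewrite sumE; apply: eq_bigr => y _; rewrite f_edge.
Qed.

Lemma fan_free_isomorphic G H : isomorphic G H -> fan_free H -> fan_free G.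
Proof.
case=> f /bij_inj f_inj f_edge ff h p q r s.
rewrite -!f_edge -!(inj_eq f_inj); exact: ff.
Qed.

Lemma path_sq5_free G : reflect (fan_free G) (~~ contains G (path_sq 5)).
Proof.
apply: (iffP idP) => [no_fan h p q r s hp hq hr hs pq qr rs pr ps qs|ff].
  case/negP: no_fan; apply/existsP.
  (* The hub goes to the middle index 2, the only vertex of the squared path within distance 2 of
     all others. *)
  pose t := [:: p; q; h; r; s].
  exists [ffun i : 'I_5 => nth h t i]; apply/andP; split.
    apply/injectiveP => i j; rewrite !ffunE => /eqP.
    rewrite nth_uniq ?ltn_ord //; first by move/eqP/val_inj.
    rewrite /t /= !inE !negb_or !(eq_sym _ h).
    by rewrite pr ps qs !sedge_neq // eq_sym sedge_neq.
  apply/forallP => -[j ltj5]; apply/forallP => -[k ltk5].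
  apply/implyP; rewrite !ffunE /= /path_sq_rel.
  move: j k ltj5 ltk5.
  move=> [|[|[|[|[|//]]]]] [|[|[|[|[|//]]]]] lej lek //=;
    by rewrite /t /= // sedge_sym.
apply/existsP => -[f /andP[/injectiveP f_inj /forallP f_edge]].
have fE i j (ltj : j < 5) (lti : i < 5): path_sq_rel (Ordinal lti) (Ordinal ltj) ->
    sedge (f (Ordinal lti)) (f (Ordinal ltj)).
  by move/forallP: (f_edge (Ordinal lti)) => /(_ (Ordinal ltj)) /implyP.
pose v i (lti : i < 5) := f (Ordinal lti).
by apply: (ff (v 2 isT) (v 0 isT) (v 1 isT) (v 3 isT) (v 4 isT));
  rewrite ?(inj_eq f_inj) //; apply: fE.
Qed.

(** * The candidate graphs: absence of fans and number of edges *)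

(** A hub in Y has its path inside X, where degrees are at most 1. A hub in X has at most one
    neighbour in X, so two consecutive path vertices would lie in the independent set Y. *)
Lemma E_graph_fan_free n i : fan_free (E_graph n i).
Proof.
move=> h p q r s /=; rewrite /E_rel -!val_eqE /=.
move: (val h) (val p) (val q) (val r) (val s) => {}h {}p {}q {}r {}s.
case: (ltnP h i) => _; case: (ltnP p i) => _; case: (ltnP q i) => _;
  case: (ltnP r i) => _; case: (ltnP s i) => _ //=; lia.
Qed.

Lemma sum_half_pairs i :
  \sum_(x < i) \sum_(y < i) ((x != y :> nat) && (x./2 == y./2)) = i./2 * 2.
Proof.
(* An index has a smaller partner, its predecessor, exactly when it is odd. *)
have row j : \sum_(y < j) ((j != y) && (j./2 == y./2)) = odd j :> nat.
  case: j => [|j]; first by rewrite big_ord0.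
  rewrite big_ord_recr big1 => [/=|y _]; last by case: y => y /=; lia.
  lia.
elim: i => [|i IHi]; first by rewrite big_ord0.
rewrite big_ord_recr /=; under eq_bigr do rewrite big_ord_recr /=.
rewrite big_split /= IHi big_ord_recr /= row eqxx /=.
under [X in _ + X + _]eq_bigr do rewrite eq_sym [_./2 == _]eq_sym.
by rewrite row; lia.
Qed.

Lemma E_graph_edges n i : i <= n -> #|edges (E_graph n i)| = i * (n - i) + i./2.
Proof.
move=> le_in; pose X := [set x : E_graph n i | x < i].
have ltX (x : E_graph n i) : (x \in X) = (x < i) by rewrite inE.
have cardX : #|X| = i.
  rewrite -sum1_card; under eq_bigl do rewrite ltX.
  by rewrite (big_ord_narrow le_in) /= sum1_card card_ord.
have cardY : #|~: X| = n - i.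
  by have := cardsC X; rewrite cardX card_ord; lia.
have degX : degsum X = i./2 * 2.
  rewrite /degsum; under eq_bigl do rewrite ltX.
  rewrite (big_ord_narrow le_in) /= -sum_half_pairs; apply: eq_bigr => x _.
  under eq_bigl do rewrite ltX.
  rewrite (big_ord_narrow le_in) /=; apply: eq_bigr => y _.
  by rewrite /E_rel /= !ltn_ord.
have degY : degsum (~: X) = 0.
  rewrite /degsum big1 // => x xY; rewrite big1 // => y yY.
  by move: xY yY; rewrite !inE /= /E_rel => /negPf-> /negPf->.
have degXY : \sum_(x in ~: X) \sum_(y in X) sedge x y = (n - i) * i.
  rewrite -cardY -[in RHS]cardX -sum_nat_const; apply: eq_bigr => x xY.
  rewrite -sum1_card; apply: eq_bigr => y yX.
  by move: xY yX; rewrite !inE /= /E_rel => /negPf-> ->.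
have := degsum_setD (subsetT X); rewrite setTD degX degY degXY degsum_edges.
nia.
Qed.

Lemma G0_fan_free : fan_free G0.
Proof.
move=> h p q r s /=; rewrite /G0_rel -!val_eqE /=.
case: h p q r s => h lth [p ltp] [q ltq] [r ltr] [s lts] /=.
move: h p lth ltp => [|[|[|[|[|//]]]]] [|[|[|[|[|//]]]]] _ _ //= _;
  move: q ltq => [|[|[|[|[|//]]]]] _ //= _;
  move: r ltr => [|[|[|[|[|//]]]]] _ //= _;
  move: s lts => [|[|[|[|[|//]]]]] _ //=.
Qed.

Lemma G0_edges : #|edges G0| = 7.
Proof.
suff : degsum [set: G0] = 14 by rewrite degsum_edges; lia.
rewrite /degsum; under eq_bigl do rewrite inE.
under eq_bigr do under eq_bigl do rewrite inE.
by rewrite /= !big_ord_recl !big_ord0.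
Qed.

Lemma mem_edges G (x y : G) : ([set x; y] \in edges G) = sedge x y.
Proof.
rewrite inE; apply/existsP/idP => [[u /existsP[v /andP[uv /eqP/setP xy]]]|xy].
  have := xy u; have := xy v; have := xy x; have := xy y.
  rewrite !inE !eqxx ?orbT /= => /esym/orP[]/eqP-> /esym/orP[]/eqP-> //.
  - by rewrite orbb => /eqP vu; move: uv; rewrite vu sedge_irrefl.
  - by rewrite sedge_sym.
  - by rewrite !orbb => _ /eqP vu; move: uv; rewrite vu sedge_irrefl.
by exists x; apply/existsP; exists y; rewrite xy eqxx.
Qed.

(** * The value of the extremal number *)

(** As [ex] ranges over edge sets, this makes a concrete graph on ['I_n] a competitor in the
    maximum. *)
Lemma graph_of_edges G : isomorphic (graph_of (edges G)) G.
Proof.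
exists id; first by exists id.
move=> x y /=; rewrite /edge_rel mem_edges.
by case: (boolP (@sedge G x y)) => [/sedge_neq->|_]; rewrite ?andbF.
Qed.

Lemma fan_free_edges G :
  fan_free G -> 5 <= #|G| -> #|edges G| <= (#|G| ^ 2 + #|G|) %/ 4.
Proof.
move=> ff G5; have := degsum_fan_free [set: G] ff.
rewrite degsum_edges cardsT leq_divRL //; have -> : #|G| == 4 = false by lia.
lia.
Qed.

(** The part size ceil(n/2) attains the bound in every residue class modulo 4, which supplies the
    lower bound on [ex]. *)
Lemma uphalf_edges n :
  uphalf n * (n - uphalf n) + (uphalf n)./2 = (n ^ 2 + n) %/ 4.
Proof.
have [q [r [lt_r4 ->]]] : exists q r, r < 4 /\ n = q * 4 + r.
  by exists (n %/ 4), (n %% 4); rewrite ltn_mod -divn_eq.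
case: r lt_r4 => [|[|[|[|//]]]] _.
- have -> : uphalf (q * 4 + 0) = q * 2 by lia.
  have -> : (q * 2)./2 = q by lia.
  have -> : (q * 4 + 0) ^ 2 + (q * 4 + 0) = (q * q * 4 + q) * 4 by lia.
  by rewrite mulnK //; nia.
- have -> : uphalf (q * 4 + 1) = q * 2 + 1 by lia.
  have -> : (q * 2 + 1)./2 = q by lia.
  have -> : (q * 4 + 1) ^ 2 + (q * 4 + 1) = (q * q * 4 + q * 3) * 4 + 2 by lia.
  by rewrite divnMDl //; nia.
- have -> : uphalf (q * 4 + 2) = q * 2 + 1 by lia.
  have -> : (q * 2 + 1)./2 = q by lia.
  have -> : (q * 4 + 2) ^ 2 + (q * 4 + 2) = (q * q * 4 + q * 5 + 1) * 4 + 2 by lia.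
  by rewrite divnMDl //; nia.
- have -> : uphalf (q * 4 + 3) = q * 2 + 2 by lia.
  have -> : (q * 2 + 2)./2 = q + 1 by lia.
  have -> : (q * 4 + 3) ^ 2 + (q * 4 + 3) = (q * q * 4 + q * 7 + 3) * 4 by lia.
  by rewrite mulnK //; nia.
Qed.

Lemma ex_path_sq5 n : 5 <= n -> ex n (path_sq 5) = (n ^ 2 + n) %/ 4.
Proof.
move=> n5; apply/eqP; rewrite eqn_leq; apply/andP; split.
  apply/bigmax_leqP => S /path_sq5_free/fan_free_edges.
  by rewrite card_ord; apply.
have le_un : uphalf n <= n by lia.
have iso := graph_of_edges (E_graph n (uphalf n)).
rewrite -uphalf_edges -E_graph_edges // -(isomorphic_edges iso).
apply: leq_bigmax_cond; apply/path_sq5_free.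
exact: fan_free_isomorphic iso (@E_graph_fan_free _ _).
Qed.

(** * Classification of the extremal graphs *)

Lemma E_graph_extremal n i G :
  5 <= n -> i <= n -> i * (n - i) + i./2 = (n ^ 2 + n) %/ 4 ->
  isomorphic G (E_graph n i) -> extremal n (path_sq 5) G.
Proof.
move=> n5 le_in max_i iso; split.
- by rewrite (isomorphic_card iso) card_ord.
- exact/path_sq5_free/(fan_free_isomorphic iso)/E_graph_fan_free.
- by rewrite (isomorphic_edges iso) E_graph_edges // max_i ex_path_sq5.
Qed.

Lemma G0_extremal G : isomorphic G G0 -> extremal 5 (path_sq 5) G.
Proof.
move=> iso; split.
- by rewrite (isomorphic_card iso) card_ord.
- exact/path_sq5_free/(fan_free_isomorphic iso)/G0_fan_free.
- by rewrite (isomorphic_edges iso) G0_edges ex_path_sq5.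
Qed.

Lemma extremal_cases n G :
  5 <= n -> extremal n (path_sq 5) G ->
  n = 5 /\ isomorphic G G0 \/
  exists i, [/\ i <= n, i * (n - i) + i./2 = (n ^ 2 + n) %/ 4 &
                isomorphic G (E_graph n i)].
Proof.
move=> n5 [cardG /path_sq5_free ff]; rewrite ex_path_sq5 // => edgesG.
have near : #|G| ^ 2 + #|G| <= degsum [set: G] * 2 + 2.
  rewrite degsum_edges edgesG cardG.
  have even_n : ~~ odd (n ^ 2 + n) by rewrite oddD oddX /= addbb.
  lia.
have G5 : 5 <= #|G| by rewrite cardG.
have [[n_5 K4]|[X [mX iY]]] := near_extremal_cases ff G5 near.
  left; rewrite -cardG n_5; split=> //; apply: extremal5_K4 => //.
  by move: near; rewrite n_5; lia.
right; have [XY one] := near_extremal_structure near mX iY.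
have := isomorphic_E_graph mX iY XY one; rewrite cardG => iso.
have le_Xn : #|X| <= n by rewrite -cardG max_card.
exists #|X|; split=> //.
by rewrite -E_graph_edges // -(isomorphic_edges iso) edgesG.
Qed.

(** With j = n - i and k = j - i, maximality says k^2 + k <= 2 for even i and k^2 + k <= 0 for odd
    i. Hence k is one of -2, -1, 0, 1, respectively one of -1, 0. *)
Lemma E_graph_max_part n i :
  i <= n -> i * (n - i) + i./2 = (n ^ 2 + n) %/ 4 ->
  if odd i then n + 1 = i * 2 \/ n = i * 2
  else n + 2 = i * 2 \/ n + 1 = i * 2 \/ n = i * 2 \/ n = i * 2 + 1.
Proof.
move=> le_in max_i.
have {max_i} : n ^ 2 + n <= (i * (n - i) + i./2) * 4 + 2.
  have even_n : ~~ odd (n ^ 2 + n) by rewrite oddD oddX /= addbb.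
  rewrite max_i; lia.
rewrite -(subnKC le_in) addKn; have := odd_double_half i.
move: (n - i) (odd i) (i./2) => j b m {le_in}; rewrite -muln2.
case: b => <- /=.
  have [mj|jm] := leqP (m * 2 + 1) j.
    by rewrite -(subnKC mj); move: (j - _) => k; nia.
  have [k jE] : exists k, m * 2 + 1 = j + k by exists (m * 2 + 1 - j); lia.
  nia.
have [mj|jm] := leqP (m * 2) j => max_i.
  have [k jE] : exists k, j = m * 2 + k by exists (j - m * 2); lia.
  have : k <= 1 by rewrite jE in max_i; nia.
  by move: jE; lia.
have [k jE] : exists k, m * 2 = j + k by exists (m * 2 - j); lia.
have : k <= 2 by nia.
by move: jE; lia.
Qed.

Theorem theorem4 (n : nat) (hn : 5 <= n) :
  [/\ n = 5 ->
        forall G : sgraph, extremal n (path_sq 5) G <->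
          [\/ isomorphic G (E_graph 5 2), isomorphic G (E_graph 5 3)
            | isomorphic G G0],
      6 <= n -> n %% 4 = 1 ->
        forall G : sgraph, extremal n (path_sq 5) G <->
          isomorphic G (E_graph n (uphalf n)) \/
          isomorphic G (E_graph n n./2),
      6 <= n -> n %% 4 = 2 ->
        forall G : sgraph, extremal n (path_sq 5) G <->
          isomorphic G (E_graph n n./2) \/
          isomorphic G (E_graph n (n./2 + 1))
    & 6 <= n -> n %% 4 = 0 \/ n %% 4 = 3 ->
        forall G : sgraph, extremal n (path_sq 5) G <->
          isomorphic G (E_graph n (uphalf n))].
Proof.
have uphalf_ext G : isomorphic G (E_graph n (uphalf n)) ->
    extremal n (path_sq 5) G.
  by apply: E_graph_extremal (uphalf_edges n); lia.
split=> [n5|n6 n_1|n6 n_2|n6 n_03] G.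
- subst n; split=> [/(extremal_cases hn)[[_ iso]|[i [lei /E_graph_max_part]]]|].
  + exact: Or33.
  (* Of the part sizes 0 to 5 only 2 and 3 pass the test. *)
  + move=> /(_ lei); case: i lei => [|[|[|[|[|[|//]]]]]] _ /=;
      move=> max_i; first [by exfalso; lia | by apply: Or31 | by apply: Or32].
  + by case; [apply: E_graph_extremal | apply: E_graph_extremal
             | apply: G0_extremal].
- split=> [/(extremal_cases hn)[[n5 _]|[i [lei /E_graph_max_part]]]|]; first lia.
    move=> /(_ lei) max_i iso.
    (* For n = 4q + 1 the odd solution is 2q + 1 and the even one is 2q. *)
    have [iE|iE] : i = uphalf n \/ i = n./2 by move: max_i; case: ifP; lia.
      by left; rewrite -iE.
    by right; rewrite -iE.
  case; first exact: uphalf_ext.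
  apply: E_graph_extremal; rewrite // -?uphalf_edges; first lia.
  have [q ->] : exists q, n = q * 4 + 1 by exists (n %/ 4); lia.
  have -> : uphalf (q * 4 + 1) = q * 2 + 1 by lia.
  have -> : (q * 4 + 1)./2 = q * 2 by lia.
  have [-> ->] : (q * 2 + 1)./2 = q /\ (q * 2)./2 = q by lia.
  nia.
- split=> [/(extremal_cases hn)[[n5 _]|[i [lei /E_graph_max_part]]]|]; first lia.
    move=> /(_ lei) max_i iso.
    (* For n = 4q + 2 the odd solution is 2q + 1 and the even one is 2q + 2. *)
    have [iE|iE] : i = n./2 \/ i = n./2 + 1 by move: max_i; case: ifP; lia.
      by left; rewrite -iE.
    by right; rewrite -iE.
  have half_n : n./2 = uphalf n by lia.
  rewrite half_n; case; first exact: uphalf_ext.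
  apply: E_graph_extremal; rewrite // -?uphalf_edges; first lia.
  have [q ->] : exists q, n = q * 4 + 2 by exists (n %/ 4); lia.
  have -> : uphalf (q * 4 + 2) = q * 2 + 1 by lia.
  have [-> ->] : (q * 2 + 1 + 1)./2 = q + 1 /\ (q * 2 + 1)./2 = q by lia.
  nia.
split=> [/(extremal_cases hn)[[n5 _]|[i [lei /E_graph_max_part]]]|];
  [lia| |exact: uphalf_ext].
move=> /(_ lei) max_i.
(* For n = 4q the only solution is 2q, for n = 4q + 3 it is 2q + 2; every other candidate has the
   wrong parity. *)
by have <- : i = uphalf n by move: max_i; case: ifP; lia.
Qed.
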